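(* Let $q\ge 4$ and let $P_1,P_2$ be two distinct points of the line $\mathrm{PG}(V)$. Then $\mathcal Y\cup\{P_1,P_2\}$ is a $4$-general set of $\Pi\cong\mathrm{PG}(5,q)$ of size $q^2-q+2$.
   Context: $q$ is a prime power. Regard $\mathbb F_{q^6}$ as a $6$-dimensional $\mathbb F_q$-vector space and let $\Pi=\mathrm{PG}(\mathbb F_{q^6})\cong\mathrm{PG}(5,q)$, whose points are $\langle x\rangle=\mathbb F_q^*x$, $x\ne0$. Let $\mathcal Y=\{\langle b-1\rangle : b\in\mathbb F_{q^6},\ b^{q^2-q+1}=1,\ b\ne 1\}$. Let $F(X)=X^{q^2}-X^q+X$ (an $\mathbb F_q$-linear map of $\mathbb F_{q^6}$) and $V=\ker F$, a $2$-dimensional $\mathbb F_q$-subspace, so $\mathrm{PG}(V)$ is a line of $\Pi$. For integers $r,s$, an $(r,s)$-set of $\mathrm{PG}(n,q)$ is a set $\mathcal X$ of points such that: (i) every $s$-dimensional projective subspace contains at most $r$ points of $\mathcal X$; (ii) $\mathcal X$ spans $\mathrm{PG}(n,q)$; (iii) some $(s+1)$-dimensional projective subspace contains $r+2$ points of $\mathcal X$. A $4$-general set is a $(3,2)$-set. *)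

(* Defs.v *)
From HB Require Import structures.
From mathcomp Require Import all_boot all_order all_algebra all_field.
Set Implicit Arguments. Unset Strict Implicit. Unset Printing Implicit Defensive.
Import GRing.Theory.
Local Open Scope ring_scope.

(* The field F_{q^6} is modelled as a field extension L of degree 6 of a
   finite field K with #|K| = q; [finvect_type L] is L with its canonical
   finite-type structure.  PG(L) over K: a point is a 1-dimensional
   K-subspace <[x]> (x != 0); a projective subspace of projective
   dimension s is a K-subspace of dimension s+1.  A finite point set is
   represented by a duplicate-free sequence of points. *)

Section Defs.
Variables (K : finFieldType) (L : fieldExtType K).
Local Notation T := (finvect_type L).

Definition is_point (P : {vspace T}) := \dim P == 1%N.

Definition npts (X : seq {vspace T}) (W : {vspace T}) : nat :=
  count (fun P => (P <= W)%VS) X.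

Definition rs_set (r s : nat) (X : seq {vspace T}) : Prop :=
  [/\ all is_point X, uniq X,
      (forall W : {vspace T}, \dim W = s.+1 -> (npts X W <= r)%N),
      (\sum_(P <- X) P)%VS = fullv
    & exists W : {vspace T}, \dim W = s.+2 /\ (r.+2 <= npts X W)%N].

Definition four_general (X : seq {vspace T}) : Prop := rs_set 3 2 X.

Definition Yset (q : nat) : seq {vspace T} :=
  undup [seq <[b - 1]>%VS | b <- enum T & (b ^+ (q ^ 2 - q + 1) == 1) && (b != 1)].

Definition Fmap (q : nat) (x : T) : T := x ^+ (q ^ 2) - x ^+ q + x.

End Defs.

(* Main.v *)
Require Import Defs.
From HB Require Import structures.
From mathcomp Require Import all_boot all_order all_algebra all_field all_solvable.
From mathcomp Require Import ring zify.
Set Implicit Arguments. Unset Strict Implicit. Unset Printing Implicit Defensive.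
Import GRing.Theory.
Local Open Scope ring_scope.

(** Write [N = q^2 - q + 1] and [c = b^q].  If [b^N = 1], the conjugates of [b]
    over [K] are [b, c, c/b, 1/b, 1/c, b/c], and if [v] is in the kernel of [F],
    those of [v] are [v, v^q, v^q - v, -v, -v^q, v - v^q].  These are the six
    outer monomials of the anticanonical model of the sextic del Pezzo surface
    and their differentials at the identity: the points of [Y] are points of a
    torus [(b, c)], and the line PG(V) consists of the tangent directions at
    [(1, 1)].

    No three points [(1 : b : c)] with [b^N = 1] are collinear, and neither are
    three points [(1 : 1/b : 1/c)].  A product of a line of the first plane and
    a line of the second one involves only the monomials above, so four
    dependent points are excluded by choosing two lines that cover all of them
    but one; two lines through [(1, 1)] also kill every tangent direction.

    The differences [b - 1] span a subring, hence a subfield, of degree dividing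
    6, and the proper divisors are ruled out by the action of the Frobenius.

    For five points in a solid, [b - 1/b] and [x1] lie in the set of solutions of
    [z^(q^3) = -z], which has at most [q^3] elements.  If [q >= 4], pigeonhole gives
    [a] and [b] with [x1], [a - 1/a] and [b - 1/b] dependent, so that [x1] and
    the four points of [a, 1/a, b, 1/b] lie in a solid. *)

(** * The [q]-power map as a [K]-linear endomorphism of the field *)

Lemma frob_iter3 (R : pzSemiRingType) (x : R) (q : nat) :
  x ^+ (q ^ 3) = x ^+ q ^+ q ^+ q.
Proof. by rewrite -!exprM; congr (_ ^+ _); lia. Qed.

Section Frobenius.
Variables (K : finFieldType) (L : fieldExtType K) (q : nat).
Hypothesis hK : #|K| = q.

Lemma frobD (x y : L) : (x + y) ^+ q = x ^+ q + y ^+ q.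
Proof.
have [p p_pr pK] := finPcharP K.
have pL : p \in [char L] by rewrite pchar_lalg.
apply: exprDn_pchar; rewrite (eq_pnat _ (pcharf_eq pL)) -hK.
by rewrite (@card_pprimeChar p K pK) pnatX pnat_id.
Qed.

Lemma frob0 : (0 : L) ^+ q = 0.
Proof. by rewrite expr0n -hK (gtn_eqF (ltnW (finNzRing_gt1 K))). Qed.

Lemma frobN (x : L) : (- x) ^+ q = - x ^+ q.
Proof. by apply/eqP; rewrite -addr_eq0 -frobD addNr frob0. Qed.

Lemma frobB (x y : L) : (x - y) ^+ q = x ^+ q - y ^+ q.
Proof. by rewrite frobD frobN. Qed.

Lemma frobZ (k : K) (x : L) : (k *: x) ^+ q = k *: x ^+ q.
Proof. by rewrite exprZn -{1}hK expf_card. Qed.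

End Frobenius.

(** * The group of [N]-th roots of unity and its two arcs *)

Section RootsOfUnity.
Variables (K : finFieldType) (L : fieldExtType K) (q : nat).
Hypothesis hK : #|K| = q.

Definition in_muN (b : L) := b ^+ (q ^ 2 - q + 1) == 1.
Local Notation muN := in_muN.

Lemma q_gt1 : (1 < q)%N.
Proof. by rewrite -hK finNzRing_gt1. Qed.

Lemma q_le_sqr : (q <= q ^ 2)%N.
Proof. by rewrite -{1}[q]expn1 leq_pexp2l // (ltnW q_gt1). Qed.

Lemma muN1 : muN 1.
Proof. by rewrite /in_muN expr1n. Qed.

Lemma muN_neq0 b : muN b -> b != 0.
Proof.
apply: contraTneq => ->; rewrite /in_muN addn1 exprS mul0r.
by rewrite eq_sym oner_eq0.
Qed.

Lemma muNM a b : muN a -> muN b -> muN (a * b).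
Proof. by rewrite /in_muN exprMn => /eqP-> /eqP->; rewrite mulr1. Qed.

Lemma muNV b : muN b -> muN b^-1.
Proof. by rewrite /in_muN exprVn => /eqP->; rewrite invr1. Qed.

Lemma muN_frob2 b : muN b -> (b ^+ q) ^+ q = b ^+ q / b.
Proof.
move=> hb; apply: (mulIf (muN_neq0 hb)); rewrite divfK ?muN_neq0 //.
rewrite -exprM mulnn -exprSr.
have -> : (q ^ 2).+1 = ((q ^ 2 - q + 1) + q)%N by have := q_le_sqr; lia.
by rewrite exprD (eqP hb) mul1r.
Qed.

Lemma muN_frob3 b : muN b -> b ^+ (q ^ 3) = b^-1.
Proof.
move=> hb; have b0 := muN_neq0 hb.
rewrite frob_iter3 (muN_frob2 hb) expr_div_n (muN_frob2 hb).
by rewrite mulrAC divff ?expf_neq0 // mul1r.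
Qed.

(* A nontrivial linear relation between [b1 - b3] and [b2 - b3] over the fixed
   field of the Frobenius would persist under [x |-> x ^+ q ^ 3], which inverts
   the [bi]. *)
Lemma muN_arc b1 b2 b3 : muN b1 -> muN b2 -> muN b3 ->
  b1 != b2 -> b1 != b3 -> b2 != b3 ->
  (b1 - b3) * (b2 ^+ q - b3 ^+ q) - (b2 - b3) * (b1 ^+ q - b3 ^+ q) != 0.
Proof.
move=> h1 h2 h3 n12 n13 n23.
have z1 := muN_neq0 h1; have z2 := muN_neq0 h2; have z3 := muN_neq0 h3.
rewrite -!(frobB hK) subr_eq0; apply/eqP => E.
have d13 : b1 - b3 != 0 by rewrite subr_eq0.
have d23 : b2 - b3 != 0 by rewrite subr_eq0.
pose r := (b1 - b3) / (b2 - b3).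
have rq : r ^+ q = r.
  rewrite /r expr_div_n; apply/eqP; rewrite eqr_div ?expf_neq0 //.
  by rewrite mulrC -E mulrC.
have r3 : r ^+ (q ^ 3) = r by rewrite frob_iter3 !rq.
have q3B (x y : L) : (x - y) ^+ (q ^ 3) = x ^+ (q ^ 3) - y ^+ (q ^ 3).
  by rewrite !frob_iter3 !(frobB hK).
move: r3; rewrite {1}/r expr_div_n !q3B !muN_frob3 // /r => H.
case/eqP: n12; move: H.
have -> : b1^-1 - b3^-1 = (b3 - b1) / (b1 * b3) by field; rewrite z1 z3.
have -> : b2^-1 - b3^-1 = (b3 - b2) / (b2 * b3) by field; rewrite z2 z3.
have d32 : b3 - b2 != 0 by rewrite subr_eq0 eq_sym.
move=> H.
(* The [q^3]-power map sends [r] to [r * b2 / b1]; the expression below is the difference from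
   [r]. *)
have : (b1 - b3) / (b2 - b3) * (b2 - b1) / b1 = 0.
  transitivity ((b3 - b1) / (b1 * b3) / ((b3 - b2) / (b2 * b3)) -
                (b1 - b3) / (b2 - b3)); last by rewrite H subrr.
  by field; rewrite z1 z2 z3 d23 d32.
move/eqP; rewrite !mulf_eq0 !invr_eq0 (negPf d13) (negPf d23) (negPf z1) /= orbF.
by rewrite subr_eq0 => /eqP.
Qed.

(** Inversion permutes the [N]-th roots of unity and commutes with the Frobenius. *)
Lemma muN_dual_arc b1 b2 b3 : muN b1 -> muN b2 -> muN b3 ->
  b1 != b2 -> b1 != b3 -> b2 != b3 ->
  (b1^-1 - b3^-1) * ((b2 ^+ q)^-1 - (b3 ^+ q)^-1)
  - (b2^-1 - b3^-1) * ((b1 ^+ q)^-1 - (b3 ^+ q)^-1) != 0.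
Proof.
move=> h1 h2 h3 n12 n13 n23; rewrite -!exprVn.
by apply: muN_arc; rewrite ?muNV // (inj_eq invr_inj).
Qed.

(** * Conjugates of a linear relation and their bilinear combinations *)

Section Relations.
Variables (n : nat) (k : 'I_n -> K) (b : 'I_n -> L) (v : L).
Hypothesis vV : v ^+ q ^+ q = v ^+ q - v.
Hypothesis hb : forall i, muN (b i).
Hypothesis rel0 : v + \sum_i k i *: (b i - 1) = 0.

Let c i := b i ^+ q.

(** The coefficients [k i] lie in [K], so the Frobenius fixes them. *)
Lemma frob_rel (w : L) (e : 'I_n -> L) : w + \sum_i k i *: (e i - 1) = 0 ->
  w ^+ q + \sum_i k i *: (e i ^+ q - 1) = 0.
Proof.
move/(congr1 (fun z => z ^+ q)); rewrite (frobD hK) (frob0 L hK) => E; rewrite -[RHS]E; congr (_ + _).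
rewrite (big_morph (fun z : L => z ^+ q) (frobD hK) (frob0 L hK)).
by apply: eq_bigr => i _; rewrite (frobZ hK) (frobB hK) expr1n.
Qed.

Lemma conj_rel1 : v ^+ q + \sum_i k i *: (c i - 1) = 0.
Proof. exact: frob_rel rel0. Qed.

Lemma conj_rel2 : v ^+ q - v + \sum_i k i *: (c i / b i - 1) = 0.
Proof.
have := frob_rel conj_rel1; rewrite vV => E; rewrite -[RHS]E; congr (_ + _).
by apply: eq_bigr => i _; rewrite muN_frob2.
Qed.

Lemma conj_rel3 : - v + \sum_i k i *: ((b i)^-1 - 1) = 0.
Proof.
have := frob_rel conj_rel2; rewrite (frobB hK) vV => E; rewrite -[RHS]E.
congr (_ + _); first by ring.
apply: eq_bigr => i _; rewrite expr_div_n muN_frob2 //.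
by rewrite mulrAC divff ?mul1r // expf_neq0 // muN_neq0.
Qed.

Lemma conj_rel4 : - v ^+ q + \sum_i k i *: ((c i)^-1 - 1) = 0.
Proof.
have := frob_rel conj_rel3; rewrite (frobN hK) => E; rewrite -[RHS]E; congr (_ + _).
by apply: eq_bigr => i _; rewrite exprVn.
Qed.

Lemma conj_rel5 : v - v ^+ q + \sum_i k i *: (b i / c i - 1) = 0.
Proof.
have := frob_rel conj_rel4; rewrite (frobN hK) vV => E; rewrite -[RHS]E.
congr (_ + _); first by ring.
by apply: eq_bigr => i _; rewrite exprVn muN_frob2 // invf_div.
Qed.

(* The conjugate relations, with [v] eliminated, say that the points
   [(b - 1 : c - 1)] and [(b^-1 - 1 : c^-1 - 1)] of the two rulings of a
   quadric have linearly dependent tensor products. *)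
Lemma tensor_rel (s t s' t' : L) :
  \sum_i k i *: ((s * (b i - 1) + t * (c i - 1)) *
                 (s' * ((b i)^-1 - 1) + t' * ((c i)^-1 - 1))) = 0.
Proof.
pose S (f : 'I_n -> L) := \sum_i k i *: f i.
have r0 : S (fun i => b i - 1) = - v by apply/eqP; rewrite -addr_eq0 addrC rel0.
have r1 : S (fun i => c i - 1) = - v ^+ q.
  by apply/eqP; rewrite -addr_eq0 addrC conj_rel1.
have r2 : S (fun i => c i / b i - 1) = - (v ^+ q - v).
  by apply/eqP; rewrite -addr_eq0 addrC conj_rel2.
have r3 : S (fun i => (b i)^-1 - 1) = - (- v).
  by apply/eqP; rewrite -addr_eq0 addrC conj_rel3.
have r4 : S (fun i => (c i)^-1 - 1) = - (- v ^+ q).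
  by apply/eqP; rewrite -addr_eq0 addrC conj_rel4.
have r5 : S (fun i => b i / c i - 1) = - (v - v ^+ q).
  by apply/eqP; rewrite -addr_eq0 addrC conj_rel5.
have SE : forall f, S f = \sum_i (k i)%:A * f i.
  by move=> f; apply: eq_bigr => i _; rewrite mulr_algl.
(* Identities such as [(b - 1) (1/c - 1) = (b/c - 1) - (b - 1) - (1/c - 1)] reduce the products to
   the six conjugate sums, whose contributions in [v] cancel. *)
transitivity
 (- (s * s') * (S (fun i => b i - 1) + S (fun i => (b i)^-1 - 1))
  - t * t' * (S (fun i => c i - 1) + S (fun i => (c i)^-1 - 1))
  + t * s' * (S (fun i => c i / b i - 1) - S (fun i => c i - 1)
              - S (fun i => (b i)^-1 - 1))
  + s * t' * (S (fun i => b i / c i - 1) - S (fun i => b i - 1)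
              - S (fun i => (c i)^-1 - 1))).
  rewrite !SE -!sumrB -!big_split /= !mulr_sumr -sumrB -!big_split /=.
  apply: eq_bigr => i _; rewrite -[LHS]mulr_algl.
  have b0 := muN_neq0 (hb i); have c0 : c i != 0 by rewrite expf_neq0.
  by move: (k i)%:A (b i) (c i) b0 c0 => u x y b0 c0; field; rewrite b0 c0.
by rewrite r0 r1 r2 r3 r4 r5; ring.
Qed.

(** Without a tangent term, [rel0] and [conj_rel1] absorb the constant [u], so the second line no
    longer has to pass through [(1, 1)]. *)
Lemma affine_rel (s t s' t' u : L) : v = 0 ->
  \sum_i k i *: ((s * (b i - 1) + t * (c i - 1)) *
                 (s' * ((b i)^-1 - 1) + t' * ((c i)^-1 - 1) + u)) = 0.
Proof.
move=> v0; have r0 := rel0; have r1 := conj_rel1; move: r0 r1.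
rewrite v0 (frob0 L hK) !add0r => r0 r1.
transitivity (u * s * (\sum_i k i *: (b i - 1))
            + u * t * (\sum_i k i *: (c i - 1))); last first.
  by rewrite r0 r1 !mulr0 addr0.
rewrite -[LHS]subr0 -[X in _ - X](tensor_rel s t s' t') -sumrB !mulr_sumr.
rewrite -big_split; apply: eq_bigr => i _ /=.
rewrite -scalerBr -!scalerAr -scalerDr; congr (_ *: _); ring.
Qed.

End Relations.

(** * Independence of four points, with or without a tangent direction *)

Local Notation inV v := (v ^+ q ^+ q = v ^+ q - v).

Lemma inV0 : inV (0 : L).
Proof. by rewrite !(frob0 L hK) subr0. Qed.

(** Two lines through [(1, 1)], one through [b1] and one, in inverted coordinates, through [b2],
    leave only the term of [b3]. The points [b1] and [b2] may coincide, which later yields the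
    shorter relations. *)
Lemma tangent_last (v b1 b2 b3 : L) (k1 k2 k3 : K) : inV v ->
  muN b1 -> muN b2 -> muN b3 -> b1 != 1 -> b2 != 1 -> b3 != 1 ->
  b1 != b3 -> b2 != b3 ->
  v + (k1 *: (b1 - 1) + (k2 *: (b2 - 1) + k3 *: (b3 - 1))) = 0 -> k3 = 0.
Proof.
move=> vV h1 h2 h3 n1 n2 n3 n13 n23 E.
pose b (i : 'I_3) := [:: b1; b2; b3]`_i.
pose k (i : 'I_3) := [:: k1; k2; k3]`_i.
have hb i : muN (b i) by case: i => [[|[|[|i]]] lt_i].
have E' : v + \sum_i k i *: (b i - 1) = 0 by rewrite !big_ord_recl big_ord0 addr0.
have := tensor_rel vV hb E' (b1 ^+ q - 1) (- (b1 - 1)) 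
          ((b2 ^+ q)^-1 - 1) (- (b2^-1 - 1)).
rewrite !big_ord_recl big_ord0 /b /k /= !mulNr.
rewrite (mulrC (b1 - 1)) subrr mul0r scaler0 add0r.
rewrite (mulrC (b2^-1 - 1)) subrr mulr0 scaler0 add0r addr0.
move/eqP; rewrite scaler_eq0 => /orP[/eqP //|].
rewrite mulf_eq0 => /orP[] H.
  case/negP: (muN_arc h1 h3 muN1 n13 n1 n3).
  rewrite -oppr_eq0 -(eqP H) expr1n; apply/eqP; ring.
case/negP: (muN_dual_arc h2 h3 muN1 n23 n2 n3).
rewrite -oppr_eq0 -(eqP H) expr1n invr1; apply/eqP; ring.
Qed.

Lemma tangent_free (v b1 b2 b3 : L) (k1 k2 k3 : K) : inV v ->
  muN b1 -> muN b2 -> muN b3 -> b1 != 1 -> b2 != 1 -> b3 != 1 ->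
  b1 != b2 -> b1 != b3 -> b2 != b3 ->
  v + (k1 *: (b1 - 1) + (k2 *: (b2 - 1) + k3 *: (b3 - 1))) = 0 ->
  [/\ k1 = 0, k2 = 0 & k3 = 0].
Proof.
move=> vV h1 h2 h3 n1 n2 n3 n12 n13 n23 E; split.
- apply: (@tangent_last v b2 b3 b1 k2 k3) => //; rewrite 1?eq_sym //.
  by rewrite -[RHS]E; congr (_ + _); rewrite [RHS]addrC -!addrA.
- apply: (@tangent_last v b1 b3 b2 k1 k3) => //; rewrite 1?eq_sym //.
  by rewrite [k3 *: _ + _]addrC.
- exact: (@tangent_last v b1 b2 b3 k1 k2).
Qed.

(** A line through [(1, 1)] and [b1], and one in inverted coordinates through [b2] and [b3], leave
    only the term of [b4]; the two arc lemmas make its factors nonzero. *)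
Lemma muN_last (b1 b2 b3 b4 : L) (k1 k2 k3 k4 : K) :
  muN b1 -> muN b2 -> muN b3 -> muN b4 -> b1 != 1 -> b4 != 1 ->
  uniq [:: b1; b2; b3; b4] ->
  k1 *: (b1 - 1) + (k2 *: (b2 - 1) + (k3 *: (b3 - 1) + k4 *: (b4 - 1))) = 0 ->
  k4 = 0.
Proof.
move=> h1 h2 h3 h4 n1 n4 /=; rewrite !inE !negb_or -!andbA andbT.
case/and4P=> n12 n13 n14 /and3P[n23 n24 n34] E.
pose b (i : 'I_4) := [:: b1; b2; b3; b4]`_i.
pose k (i : 'I_4) := [:: k1; k2; k3; k4]`_i.
have hb i : muN (b i) by case: i => [[|[|[|[|i]]]] lt_i].
have E' : 0 + \sum_i k i *: (b i - 1) = 0.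
  by rewrite !big_ord_recl big_ord0 addr0 add0r.
(* The direction [(s', t')] gives the second factor equal values at [b2] and [b3]; the constant term
   passed below makes that value zero. *)
pose s' := (b2 ^+ q)^-1 - (b3 ^+ q)^-1; pose t' := - (b2^-1 - b3^-1).
have := affine_rel inV0 hb E' (b1 ^+ q - 1) (- (b1 - 1)) s' t'
          (- (s' * (b3^-1 - 1) + t' * ((b3 ^+ q)^-1 - 1))) erefl.
rewrite !big_ord_recl big_ord0 /b /k /=.
rewrite [X in k1 *: X](_ : _ = 0); last by ring.
rewrite [X in k2 *: X](_ : _ = 0); last by rewrite /s' /t'; ring.
rewrite [X in k3 *: X](_ : _ = 0); last by rewrite /s' /t'; ring.
rewrite !scaler0 !add0r addr0.
move/eqP; rewrite scaler_eq0 => /orP[/eqP //|].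
rewrite mulf_eq0 => /orP[] H.
  case/negP: (muN_arc h1 h4 muN1 n14 n1 n4).
  rewrite -oppr_eq0 -(eqP H) expr1n; apply/eqP; ring.
have n43 : b4 != b3 by rewrite eq_sym.
case/negP: (muN_dual_arc h2 h4 h3 n24 n23 n43).
rewrite -oppr_eq0 -(eqP H) /s' /t'; apply/eqP; ring.
Qed.

Lemma muN_free (b1 b2 b3 b4 : L) (k1 k2 k3 k4 : K) :
  muN b1 -> muN b2 -> muN b3 -> muN b4 ->
  b1 != 1 -> b2 != 1 -> b3 != 1 -> b4 != 1 -> uniq [:: b1; b2; b3; b4] ->
  k1 *: (b1 - 1) + (k2 *: (b2 - 1) + (k3 *: (b3 - 1) + k4 *: (b4 - 1))) = 0 ->
  [/\ k1 = 0, k2 = 0, k3 = 0 & k4 = 0].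
Proof.
move=> h1 h2 h3 h4 n1 n2 n3 n4 U E; split.
- apply: (@muN_last b2 b3 b4 b1 k2 k3 k4) => //.
    by rewrite -(rot_uniq 3).
  by rewrite -[RHS]E [RHS]addrC -!addrA.
- apply: (@muN_last b1 b3 b4 b2 k1 k3 k4) => //.
    rewrite (perm_uniq (_ : perm_eq _ [:: b1; b2; b3; b4])) //.
    by rewrite perm_cons -(perm_rot 2) perm_refl.
  by rewrite -[RHS]E; congr (_ + _); rewrite [RHS]addrC -!addrA.
- apply: (@muN_last b1 b2 b4 b3 k1 k2 k4) => //.
    rewrite (perm_uniq (_ : perm_eq _ [:: b1; b2; b3; b4])) //.
    by rewrite !perm_cons -(perm_rot 1) perm_refl.
  by rewrite [k4 *: _ + _]addrC.
- exact: (@muN_last b1 b2 b3 b4 k1 k2 k3).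
Qed.

End RootsOfUnity.

(** * Free families and a pigeonhole principle *)

Lemma size_free_leq_dim (F : fieldType) (vT : vectType F) (W : {vspace vT})
  (s : seq vT) : free s -> {subset s <= W} -> (size s <= \dim W)%N.
Proof. by move=> /eqP <- sW; apply/dimvS/span_subvP. Qed.

Lemma free4 (F : fieldType) (vT : vectType F) (u1 u2 u3 u4 : vT) :
  (forall k1 k2 k3 k4 : F,
     k1 *: u1 + (k2 *: u2 + (k3 *: u3 + k4 *: u4)) = 0 ->
     [/\ k1 = 0, k2 = 0, k3 = 0 & k4 = 0]) ->
  free [:: u1; u2; u3; u4].
Proof.
move=> H; apply/(@freeP _ _ 4 [tuple u1; u2; u3; u4]) => k.
rewrite !big_ord_recl big_ord0 addr0 /= => /H[k1 k2 k3 k4].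
case=> [[|[|[|[|i]]]] lti] //;
  [rewrite -[RHS]k1 | rewrite -[RHS]k2 | rewrite -[RHS]k3 | rewrite -[RHS]k4];
  congr k; exact: val_inj.
Qed.

Lemma card_fibre_gt2 (aT rT : finType) (f : aT -> rT) (D : {set aT})
  (A : {set rT}) : {in D, forall x, f x \in A} -> (2 * #|A| < #|D|)%N ->
  exists x y z, [/\ [/\ x \in D, y \in D & z \in D],
    [/\ x != y, y != z & z != x], f x = f y & f x = f z].
Proof.
move=> fA ltAD.
have [y yA] : exists2 y, y \in A & (2 < #|[set x in D | f x == y]|)%N.
  apply/exists_inP; apply: contraLR ltAD; rewrite negb_exists_in -leqNgt.
  move/forall_inP=> small; rewrite -sum1_card (partition_big f (mem A)) //=.
  rewrite mulnC -sum_nat_const; apply: leq_sum => y yA.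
  by have:= small y yA; rewrite -leqNgt -sum1dep_card.
case/card_gt2P=> x1 [x2 [x3 [[]]]].
rewrite !inE => /andP[D1 /eqP f1] /andP[D2 /eqP f2] /andP[D3 /eqP f3] neq.
by exists x1, x2, x3; rewrite f1 f2 f3.
Qed.

(** * Tangent directions, short relations and distinctness of the points *)

Section Geometry.
Variables (K : finFieldType) (L : fieldExtType K) (q : nat).
Local Notation T := (finvect_type L).
Hypothesis hK : #|K| = q.
Local Notation muN := (@in_muN K T q).
Local Notation inV v := (v ^+ q ^+ q = v ^+ q - v).

(** The order [N = q (q - 1) + 1] is odd, so no root of unity in the group is an involution. *)
Lemma muN_invr_neq (b : T) : muN b -> b != 1 -> b != b^-1.
Proof.
move=> hb; apply: contraNneq => bV; have b0 := muN_neq0 hb.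
have b2 : b ^+ 2 = 1 by rewrite expr2 {2}bV divff.
have oddN : odd (q ^ 2 - q + 1).
  rewrite addn1 -mulnn -{3}[q]muln1 -mulnBr /= oddM oddB ?(ltnW (q_gt1 hK)) //.
  by case: (odd q).
move: hb; rewrite /in_muN -(odd_double_half (q ^ 2 - q + 1)) oddN.
by rewrite exprD expr1 -mul2n exprM b2 expr1n mulr1.
Qed.

Lemma inVZD (k l : K) (u v : T) : inV u -> inV v -> inV (k *: u + l *: v).
Proof.
move=> hu hv; rewrite !(frobD hK) !(frobZ hK) hu hv !scalerBr.
by rewrite opprD addrACA.
Qed.

Lemma inVZ (k : K) (v : T) : inV v -> inV (k *: v).
Proof. by move=> hv; rewrite !(frobZ hK) hv scalerBr. Qed.

Lemma inV_frob3 (v : T) : inV v -> v ^+ (q ^ 3) = - v.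
Proof.
by move=> hv; rewrite frob_iter3 hv (frobB hK) hv addrAC subrr add0r.
Qed.

(** Both auxiliary points of [tangent_last] are [b^-1], with coefficient zero. *)
Lemma tangent_one (v b : T) (k : K) : inV v -> muN b -> b != 1 ->
  v + k *: (b - 1) = 0 -> k = 0.
Proof.
move=> hv hb b1 E; have nb := muN_invr_neq hb b1.
have nb' : b^-1 != b by rewrite eq_sym.
have bV1 : b^-1 != 1 by rewrite invr_eq1.
apply: (tangent_last (k1 := 0) (k2 := 0) hK hv (muNV hb) (muNV hb) hb) => //.
by rewrite !scale0r !add0r.
Qed.

Lemma tangent_two (v b1 b2 : T) (k1 k2 : K) : inV v -> muN b1 -> muN b2 ->
  b1 != 1 -> b2 != 1 -> b1 != b2 ->
  v + (k1 *: (b1 - 1) + k2 *: (b2 - 1)) = 0 -> k1 = 0 /\ k2 = 0.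
Proof.
move=> hv h1 h2 n1 n2 n12 E; have n21 : b2 != b1 by rewrite eq_sym.
split.
  apply: (tangent_last (k1 := 0) (k2 := k2) hK hv h2 h2 h1) => //.
  by rewrite scale0r add0r [_ + k1 *: _]addrC.
apply: (tangent_last (k1 := 0) (k2 := k1) hK hv h1 h1 h2) => //.
by rewrite scale0r add0r.
Qed.

Lemma line_eq (u v : T) : <[u]>%VS = <[v]>%VS -> exists k : K, u = k *: v.
Proof. by move=> E; apply/vlineP; rewrite -E memv_line. Qed.

Definition Ypar : seq T := [seq b <- enum T | muN b && (b != 1)].

Lemma mem_Ypar b : (b \in Ypar) = muN b && (b != 1).
Proof. by rewrite mem_filter mem_enum andbT. Qed.

Lemma Ypar_uniq : uniq Ypar.
Proof. exact/filter_uniq/enum_uniq. Qed.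

Lemma uniq_Ylines : uniq [seq <[b - 1]>%VS | b <- Ypar].
Proof.
rewrite map_inj_in_uniq ?Ypar_uniq // => a b.
rewrite !mem_Ypar => /andP[ha na] /andP[hb nb] /line_eq[k E].
apply/eqP/negPn/negP => nab.
have [] := tangent_two (k1 := 1) (k2 := - k) (inV0 T hK) ha hb na nb nab.
  by rewrite add0r scale1r scaleNr E subrr.
by move/eqP; rewrite oner_eq0.
Qed.

(** * Cardinalities, the span of the differences, and pairs of inverses *)

Section Cardinality.
Hypothesis hL : \dim (fullv : {vspace L}) = 6%N.

Lemma card_T : #|T| = (q ^ 6)%N.
Proof.
rewrite -(@card_vspacef K T (Vector.class T)).
rewrite (@card_vspace K T (Vector.class T)) hK; congr (_ ^ _)%N; exact: hL.
Qed.

Lemma muN_prim : {z : T | (q ^ 2 - q + 1).-primitive_root z}.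
Proof.
have q1 := q_gt1 hK.
have q6 : (1 < q ^ 6)%N by rewrite -{1}(exp1n 6) ltn_exp2r.
have /hasP/sig2W[z _ hz] : has (q ^ 6).-1.-primitive_root (enum (predC1 (0 : T))).
  apply: has_prim_root; [by lia| | exact: enum_uniq |].
    apply/allP=> x; rewrite mem_enum inE unity_rootE => /= x0; apply/eqP.
    apply: (mulfI x0); rewrite -exprS prednK ?(ltnW q6) // mulr1.
    by rewrite -card_T expf_card.
  by rewrite -cardE cardC1 card_T.
exists (z ^+ ((q ^ 6).-1 %/ (q ^ 2 - q + 1))); apply: dvdn_prim_root => //.
(* This is the factorization [q^6 - 1 = (q^3 - 1) (q + 1) (q^2 - q + 1)]. *)
apply/dvdnP; exists ((q ^ 3 - 1) * (q + 1))%N.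
case: (q) q1 => // m _; rewrite -subn1; nia.
Qed.

Lemma card_muN : #|[set b : T | muN b]| = (q ^ 2 - q + 1)%N.
Proof.
have [z hz] := muN_prim; set N := (_ + _)%N in hz *.
have -> : [set b : T | muN b] = [set z ^+ (i : 'I_N) | i in 'I_N].
  apply/setP=> b; rewrite inE; apply/idP/imsetP => [/eqP/(prim_rootP hz)[i ->]|[i _ ->]].
    by exists i.
  by rewrite /in_muN exprAC (prim_expr_order hz) expr1n.
rewrite card_imset ?card_ord // => i j /eqP.
by rewrite (eq_prim_root_expr hz) !modn_small // => /eqP/val_inj.
Qed.

Lemma size_Ypar : size Ypar = (q ^ 2 - q)%N.
Proof.
have := card_muN; rewrite (cardsD1 1) inE (muN1 T q) addn1 add1n => -[<-].
rewrite cardE; apply: perm_size.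
apply: uniq_perm; rewrite ?enum_uniq ?Ypar_uniq // => b.
by rewrite mem_Ypar mem_enum !inE andbC.
Qed.

Lemma muN_diff_span : (4 <= q)%N -> <<[seq b - 1 | b <- Ypar]>>%VS = fullv.
Proof.
move=> q4; set U := <<_>>%VS.
have UB b : muN b -> b - 1 \in U.
  move=> hb; have [->|b1] := eqVneq b 1; first by rewrite subrr mem0v.
  by apply/memv_span/map_f; rewrite mem_Ypar hb.
have [z hz] := muN_prim; have hmz : muN z by apply/eqP/prim_expr_order.
have N_gt3 : (3 < q ^ 2 - q + 1)%N by nia.
have z1 : z != 1.
  by rewrite -[z]expr1 -(prim_order_dvd hz) gtnNdvd //; lia.
have UM u v : u \in U -> v \in U -> u * v \in U.
  pose s := in_tuple [seq b - 1 | b <- Ypar] => uU vU.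
  rewrite (@coord_span _ _ _ s _ uU) (@coord_span _ _ _ s _ vU).
  rewrite mulr_suml rpred_sum // => i _.
  rewrite mulr_sumr rpred_sum // => j _.
  rewrite -scalerAl -scalerAr !rpredZ //.
  have /mapP[a] : s`_i \in [seq b - 1 | b <- Ypar] by rewrite mem_nth.
  have /mapP[b] : s`_j \in [seq b - 1 | b <- Ypar] by rewrite mem_nth.
  rewrite !mem_Ypar => /andP[hb _] -> /andP[ha _] ->.
  have -> : (a - 1) * (b - 1) = (a * b - 1) - (a - 1) - (b - 1) by ring.
  by apply: rpredB; [apply: rpredB|]; apply: UB => //; apply: muNM.
(* Some positive power of the nonzero element [z - 1] of a finite field is [1]. *)
have U1 : 1 \in U.
  have UX n : (z - 1) ^+ n.+1 \in U.
    elim: n => [|n IHn]; first by rewrite expr1 UB.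
    by rewrite exprS UM ?UB.
  have T2 : (#|T| = (#|T| - 2).+2)%N by rewrite -addn2 subnK ?finNzRing_gt1.
  have zz : z - 1 != 0 by rewrite subr_eq0.
  suff <- : (z - 1) ^+ (#|T| - 2).+1 = 1 by [].
  by apply: (mulfI zz); rewrite -exprS -T2 expf_card mulr1.
have aU : is_aspace U.
  by rewrite /is_aspace has_algid1 //=; apply/prodvP.
pose E : {subfield T} := ASpace aU.
have Umu b : muN b -> b ^+ (q ^ \dim U) = b.
  move=> hb; have : b \in E by rewrite -[b](subrK 1) memvD ?UB.
  by rewrite (Fermat's_little_theorem E) hK => /eqP.
have dimT : \dim (fullv : {vspace T}) = 6%N by exact: hL.
have /= dvd6 : (\dim E %| \dim (fullv : {vspace T}))%N.
  by apply: (@field_dimS _ _ E (aspacef T)); apply: subvf.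
apply/eqP; rewrite eqEdim subvf dimT /=.
have zq := Umu z hmz; have zV := muN_invr_neq hmz z1.
move: dvd6 zq; rewrite dimT; move: (\dim U) => d dvd6 zq.
have d_le6 : (d <= 6)%N by apply: dvdn_leq.
(* Degrees 1 and 3 would give [z = z^-1]. Degree 2 would give [z^q = z^2], hence [z^4 = z] and
   [z^3 = 1], although [z] has order [N > 3]. *)
move: d d_le6 dvd6 zq.
case=> [|[|[|[|[|[|[|d]]]]]]] // _ _.
- rewrite expn1 => zq; case/eqP: zV; rewrite -(muN_frob3 hK hmz).
  by rewrite frob_iter3 !zq.
- rewrite -mulnn exprM (muN_frob2 hK hmz) => zq.
  have z0 := muN_neq0 hmz.
  have zq2 : z ^+ q = z ^+ 2 by rewrite expr2 -[X in _ = X * _]zq divfK.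
  have z4 : z ^+ 4 = z.
    have := muN_frob2 hK hmz; rewrite zq2 exprAC zq2 -exprM => ->.
    by rewrite expr2 mulfK.
  suff : z ^+ 3 == 1 by rewrite -(prim_order_dvd hz) gtnNdvd.
  by apply/eqP/(mulfI z0); rewrite -exprS mulr1.
- by rewrite (muN_frob3 hK hmz) => zq; case/eqP: zV.
Qed.

(* The domain of [f] below has [(q^2 - q) (q - 1) q > 2 q^3] elements, so some
   fibre of [f] has three; their first components are distinct, and two of them
   are not inverse to each other. *)
Lemma symmetric_pairs (x : T) : (4 <= q)%N -> inV x -> x != 0 ->
  exists a b : T, exists k l m : K,
   [/\ [/\ a \in Ypar, b \in Ypar, a != b & a^-1 != b], l != 0
     & l *: (b - b^-1) = k *: (a - a^-1) + m *: x].
Proof.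
move=> q4 hx x0.
pose f (t : T * (K * K)) : T := t.2.1 *: (t.1 - t.1^-1) + t.2.2 *: x.
(* Requiring [k != 0] makes the coefficient [l] of the conclusion nonzero. *)
pose D := setX [set b | b \in Ypar] (setX [set k : K | k != 0] [set: K]).
pose A := [set z : T | z ^+ (q ^ 3) == - z].
have fA : {in D, forall t, f t \in A}.
  case=> b [k m]; rewrite !inE mem_Ypar /f /= => /andP[/andP[hb _] _].
  rewrite frob_iter3 !(frobD hK) !(frobZ hK) !(frobB hK) -!frob_iter3.
  rewrite (muN_frob3 hK hb) (muN_frob3 hK (muNV hb)) (inV_frob3 hx) invrK.
  by rewrite opprD -!scalerN opprB.
have cardA : (#|A| <= q ^ 3)%N.
  have q3 : (1 < q ^ 3)%N by have := q_gt1 hK; nia.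
  pose P : {poly T} := 'X^(q ^ 3) + 'X.
  have sP : size P = (q ^ 3).+1 by rewrite size_polyDl size_polyXn // size_polyX.
  have P0 : P != 0 by rewrite -size_poly_eq0 sP.
  rewrite cardE -ltnS -sP; apply: max_poly_roots => //; last exact: enum_uniq.
  apply/allP=> z; rewrite mem_enum inE => /eqP hz.
  by rewrite rootE !hornerE hz addNr.
have cardD : #|D| = ((q ^ 2 - q) * ((q - 1) * q))%N.
  rewrite !cardsX cardsT hK; congr (_ * (_ * _))%N.
    by rewrite -size_Ypar cardsE; apply/card_uniqP/Ypar_uniq.
  rewrite cardsE -hK; have /= := cardC1 (0 : K); rewrite subn1 => <-.
  by apply: eq_card => k; rewrite !inE.
have ltAD : (2 * #|A| < #|D|)%N.
  apply: (@leq_ltn_trans (2 * q ^ 3)); first by rewrite leq_mul2l cardA.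
  rewrite cardD; case: (q) q4 => // m m3; nia.
(* Since [x], [b - 1] and [b^-1 - 1] are independent, [b] and the value of [f] determine the
   scalars, so points of one fibre differ in their first components. *)
have finj b (s t : K * K) : b \in Ypar -> f (b, s) = f (b, t) -> s = t.
  rewrite mem_Ypar; case: s t => [k1 m1] [k2 m2] /andP[hb nb] E.
  have bV := muN_invr_neq hb nb.
  have nbV : b^-1 != 1 by rewrite invr_eq1.
  have [|k0 _] := tangent_two (k1 := k1 - k2) (k2 := k2 - k1)
            (inVZ (m1 - m2) hx) hb (muNV hb) nb nbV bV.
    rewrite -[k2 - k1]opprB scaleNr -scalerBr opprB addrA subrK.
    rewrite !scalerBl addrACA -opprD; apply/eqP; rewrite subr_eq0.
    by rewrite [m1 *: _ + _]addrC [m2 *: _ + _]addrC; apply/eqP.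
  move/eqP: k0; rewrite subr_eq0 => /eqP k0; move: E; rewrite /f /= k0.
  move/addrI/eqP; rewrite -subr_eq0 -scalerBl scaler_eq0 (negPf x0) orbF subr_eq0.
  by move/eqP=> ->.
have [[b1 s1] [[b2 s2] [[b3 s3] [[D1 D2 D3] [n12 n23 n31] f12 f13]]]] :=
  card_fibre_gt2 fA ltAD.
move: D1 D2 D3; rewrite !in_setX !in_set /= => /andP[Y1 _].
move=> /and3P[Y2 l2 _] /and3P[Y3 l3 _].
have m12 : b1 != b2.
  apply: contraNneq n12 => E; rewrite E in f12 Y1 *.
  by rewrite (finj _ _ _ Y1 f12).
have m13 : b1 != b3.
  apply: contraNneq n31 => E; rewrite E in f13 Y1 *.
  by rewrite (finj _ _ _ Y1 f13).
have m23 : b2 != b3.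
  apply: contraNneq n23 => E; rewrite E in f12 Y2 *.
  by rewrite (finj b3 s2 s3) // -f12.
have use b s t : f (b1, s) = f (b, t) ->
    t.1 *: (b - b^-1) = s.1 *: (b1 - b1^-1) + (s.2 - t.2) *: x.
  by rewrite /f /= scalerBl addrA => ->; rewrite addrK.
have [V12|V12] := eqVneq b1^-1 b2.
  exists b1, b3, s1.1, s3.1, (s1.2 - s3.2); split; [split|exact: l3|exact: use] => //.
  by rewrite V12.
by exists b1, b2, s1.1, s2.1, (s1.2 - s2.2); split; [split|exact: l2|exact: use].
Qed.


(** * The incidence conditions for the whole configuration *)

Section Configuration.
Variables x1 x2 : T.
Hypotheses (q4 : (4 <= q)%N) (hx1 : x1 != 0) (hx2 : x2 != 0).
Hypotheses (hV1 : inV x1) (hV2 : inV x2) (hP : <[x1]>%VS != <[x2]>%VS).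

Let X : seq {vspace T} :=
  <[x1]>%VS :: <[x2]>%VS :: [seq <[b - 1]>%VS | b <- Ypar].

Lemma inV_line_notin_Y (v : T) : v != 0 -> inV v ->
  <[v]>%VS \notin [seq <[b - 1]>%VS | b <- Ypar].
Proof.
move=> v0 hv; apply/mapP=> -[b]; rewrite mem_Ypar => /andP[hb nb] /line_eq[k E].
have k0 : - k = 0.
  by apply: (tangent_one hv hb nb); rewrite scaleNr E subrr.
by case/eqP: v0; rewrite E -[k]opprK k0 oppr0 scale0r.
Qed.

Lemma X_uniq : uniq X.
Proof.
by rewrite /= inE negb_or hP !inV_line_notin_Y // uniq_Ylines.
Qed.

Lemma x12_free (k1 k2 : K) : k1 *: x1 + k2 *: x2 = 0 -> k1 = 0 /\ k2 = 0.
Proof.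
move=> E; have [k10|k10] := eqVneq k1 0.
  move: E; rewrite k10 scale0r add0r => /eqP.
  by rewrite scaler_eq0 (negPf hx2) orbF => /eqP.
case/eqP: hP; apply/eqP; rewrite eqEdim !dim_vline hx1 hx2 leqnn andbT.
rewrite -memvE; apply/vlineP; exists (- (k1^-1 * k2)).
rewrite scaleNr -scalerA; apply: (scalerI k10); rewrite scalerN scalerKV //.
by apply/eqP; rewrite -addr_eq0 E.
Qed.

Lemma nptsE (W : {vspace T}) :
  npts X W = ((x1 \in W) + ((x2 \in W) + size [seq b <- Ypar | (b - 1)%R \in W]))%N.
Proof.
by rewrite /npts /= -!memvE size_filter count_map.
Qed.

Lemma tangent_free4 (x b1 b2 b3 : T) : x != 0 -> inV x ->
  b1 \in Ypar -> b2 \in Ypar -> b3 \in Ypar -> uniq [:: b1; b2; b3] ->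
  free [:: x; b1 - 1; b2 - 1; b3 - 1].
Proof.
rewrite !mem_Ypar /= !inE negb_or !andbT => x0 hx.
move=> /andP[h1 n1] /andP[h2 n2] /andP[h3 n3] /andP[/andP[n12 n13] n23].
apply: free4 => k0 k1 k2 k3 E.
have [k10 k20 k30] := tangent_free hK (inVZ k0 hx) h1 h2 h3 n1 n2 n3 n12 n13 n23 E.
split=> //; move: E; rewrite k10 k20 k30 !scale0r !addr0 => /eqP.
by rewrite scaler_eq0 (negPf x0) orbF => /eqP.
Qed.

(** By independence of four points, a plane with two points of [Y] misses [x1] or [x2], one with
    three misses both, and none has four. *)
Lemma npts_plane (W : {vspace T}) : \dim W = 3%N -> (npts X W <= 3)%N.
Proof.
move=> dimW; rewrite nptsE; set s := [seq _ <- _ | _].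
have sU : uniq s by apply/filter_uniq/Ypar_uniq.
have sY b : b \in s -> (b \in Ypar) && (b - 1 \in W).
  by rewrite mem_filter andbC.
have noW u1 u2 u3 u4 : free [:: u1; u2; u3; u4] ->
    [&& u1 \in W, u2 \in W, u3 \in W & u4 \in W] -> False.
  move=> /size_free_leq_dim fr /and4P[w1 w2 w3 w4].
  have := fr W; rewrite dimW ltnn => H; suff: false by [].
  by apply: H => u; rewrite !inE => /or4P[] /eqP ->.
have noxW x b1 b2 b3 : x != 0 -> inV x -> uniq [:: b1; b2; b3] ->
    {subset [:: b1; b2; b3] <= s} -> x \in W -> False.
  move=> x0 hx U sub xW.
  have /andP[Y1 W1] := sY _ (sub b1 (mem_head _ _)).
  have /andP[Y2 W2] : (b2 \in Ypar) && (b2 - 1 \in W).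
    by apply/sY/sub; rewrite !inE eqxx orbT.
  have /andP[Y3 W3] : (b3 \in Ypar) && (b3 - 1 \in W).
    by apply/sY/sub; rewrite !inE eqxx !orbT.
  by apply: (noW _ _ _ _ (tangent_free4 x0 hx Y1 Y2 Y3 U)); rewrite xW W1 W2 W3.
case: s sU sY noxW => [|b1 [|b2 [|b3 [|b4 s]]]] sU sY noxW.
- by case: (_ \in W); case: (_ \in W).
- by case: (_ \in W); case: (_ \in W).
- have [w1|_] := boolP (x1 \in W); have [w2|_] := boolP (x2 \in W) => //.
  exfalso; have /andP[Y1 W1] := sY b1 (mem_head _ _).
  have /andP[Y2 W2] : (b2 \in Ypar) && (b2 - 1 \in W).
    by apply: sY; rewrite !inE eqxx orbT.
  apply: (noW x1 x2 (b1 - 1) (b2 - 1)); last by rewrite w1 w2 W1 W2.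
  move: Y1 Y2 sU; rewrite !mem_Ypar /= inE andbT.
  move=> /andP[h1 n1] /andP[h2 n2] n12; apply: free4 => k1 k2 k3 k4 E.
  (* The combination [k1 *: x1 + k2 *: x2] is again a tangent direction. *)
  have [k30 k40] : k3 = 0 /\ k4 = 0.
    apply: (tangent_two (inVZD k1 k2 hV1 hV2) h1 h2 n1 n2 n12).
    by rewrite -[RHS]E -!addrA.
  have [] := @x12_free k1 k2; last by [].
  by move: E; rewrite k30 k40 !scale0r !addr0.
- have x1W : (x1 \in W) = false by apply/negP; apply: (noxW _ b1 b2 b3 hx1 hV1 sU).
  have x2W : (x2 \in W) = false by apply/negP; apply: (noxW _ b1 b2 b3 hx2 hV2 sU).
  by rewrite x1W x2W.
- exfalso.
  have /andP[Y1 W1] := sY b1 (mem_head _ _).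
  have /andP[Y2 W2] : (b2 \in Ypar) && (b2 - 1 \in W).
    by apply: sY; rewrite !inE eqxx orbT.
  have /andP[Y3 W3] : (b3 \in Ypar) && (b3 - 1 \in W).
    by apply: sY; rewrite !inE eqxx !orbT.
  have /andP[Y4 W4] : (b4 \in Ypar) && (b4 - 1 \in W).
    by apply: sY; rewrite !inE eqxx !orbT.
  apply: (noW (b1 - 1) (b2 - 1) (b3 - 1) (b4 - 1)); last by rewrite W1 W2 W3 W4.
  have U4 : uniq [:: b1; b2; b3; b4] by have := take_uniq 4 sU; rewrite /= take0.
  move: Y1 Y2 Y3 Y4; rewrite !mem_Ypar.
  move=> /andP[h1 n1] /andP[h2 n2] /andP[h3 n3] /andP[h4 n4].
  apply: free4 => k1 k2 k3 k4.
  exact: (muN_free hK h1 h2 h3 h4 n1 n2 n3 n4 U4).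
Qed.

Lemma X_span : (\sum_(P <- X) P)%VS = fullv.
Proof.
apply/eqP; rewrite eqEsubv subvf -(muN_diff_span q4) /=; apply/span_subvP => u.
case/mapP=> b Yb ->; rewrite memvE.
have PX : <[b - 1]>%VS \in X by rewrite !inE (map_f _ Yb) !orbT.
by rewrite (big_rem _ PX) /= addvSl.
Qed.

Lemma X_solid : exists W : {vspace T}, \dim W = 4%N /\ (5 <= npts X W)%N.
Proof.
have [a [b [k [l [m [[Ya Yb nab nVab] l0 E]]]]]] := symmetric_pairs q4 hV1 hx1.
have YV c : c \in Ypar -> c^-1 \in Ypar.
  by rewrite !mem_Ypar => /andP[hc nc]; rewrite muNV // invr_eq1.
have nV c : c \in Ypar -> c != c^-1.
  by rewrite mem_Ypar => /andP[hc nc]; apply: muN_invr_neq.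
have U3 : uniq [:: a; a^-1; b] by rewrite /= !inE negb_or nV // nab nVab.
have F := tangent_free4 hx1 hV1 Ya (YV a Ya) Yb U3.
(* The generators are free by [F], so [W] is a solid; [b^-1 - 1] falls into it by [E], as [l] is
   invertible. *)
pose W := <<[:: x1; a - 1; a^-1 - 1; b - 1]>>%VS.
have W0 : x1 \in W by apply: memv_span; rewrite !inE eqxx.
have Wa : a - 1 \in W by apply: memv_span; rewrite !inE eqxx !orbT.
have Wa' : a^-1 - 1 \in W by apply: memv_span; rewrite !inE eqxx !orbT.
have Wb : b - 1 \in W by apply: memv_span; rewrite !inE eqxx !orbT.
have Wb' : b^-1 - 1 \in W.
  have -> : b^-1 - 1 = (b - 1) - (b - b^-1) by ring.
  rewrite rpredB // -[_ - _](scalerK l0) E rpredZ //.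
  have -> : a - a^-1 = (a - 1) - (a^-1 - 1) by ring.
  by rewrite rpredD ?rpredZ // rpredB.
exists W; split; first by have /eqP := F.
rewrite nptsE W0 -[5%N]/(1 + 4)%N leq_add2l.
(* The possible contribution of [x2] is discarded. *)
apply: leq_trans (leq_addl _ _).
apply: (@uniq_leq_size _ [:: a; a^-1; b; b^-1]).
  rewrite /= !inE !negb_or nV // nab nVab (nV b) //= (inj_eq invr_inj) nab !andbT.
  by rewrite -(inj_eq invr_inj) invrK.
move=> c; rewrite !inE mem_filter => /or4P[] /eqP->;
  by rewrite ?Wa ?Wa' ?Wb ?Wb' /= ?YV.
Qed.

Lemma X_four_general : four_general X.
Proof.
split; [| exact: X_uniq | exact: npts_plane | exact: X_span | exact: X_solid].
rewrite /= /is_point !dim_vline hx1 hx2 /=; apply/allP=> P /mapP[b Yb ->].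
by move: Yb; rewrite mem_Ypar dim_vline subr_eq0 => /andP[_ ->].
Qed.

End Configuration.
End Cardinality.
End Geometry.

Theorem mainTheorem17 (K : finFieldType) (L : fieldExtType K) (q : nat)
  (hK : #|K| = q) (hq : (4 <= q)%N) (hL : \dim (fullv : {vspace L}) = 6%N)
  (x1 x2 : finvect_type L)
  (hx1 : x1 != 0) (hx2 : x2 != 0)
  (hV1 : Fmap q x1 = 0) (hV2 : Fmap q x2 = 0)
  (hP : <[x1]>%VS != <[x2]>%VS) :
  let X := undup (<[x1]>%VS :: <[x2]>%VS :: Yset L q) in
  four_general X /\ size X = (q ^ 2 - q + 2)%N.
Proof.
have inV (x : finvect_type L) : Fmap q x = 0 -> x ^+ q ^+ q = x ^+ q - x.
  rewrite /Fmap -exprM mulnn => E; apply/eqP; rewrite -subr_eq0 -[eqbRHS]E.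
  by rewrite opprB addrA addrAC.
(* All the listed points are distinct, so neither [undup] removes anything. *)
have XE : undup (<[x1]>%VS :: <[x2]>%VS :: Yset L q) =
    <[x1]>%VS :: <[x2]>%VS :: [seq <[b - 1]>%VS | b <- Ypar L q].
  have YE : Yset L q = [seq <[b - 1]>%VS | b <- Ypar L q].
    exact: undup_id (uniq_Ylines L hK).
  by rewrite YE undup_id // X_uniq //; apply: inV.
rewrite XE; split; first by apply: X_four_general => //; apply: inV.
by rewrite /= size_map (size_Ypar hK hL) addn2.
Qed.
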